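(* Let $G$ be a graph with $uv\in E(G)$ and $M\subset V(G)$. Then $|P(M,uv)|=0$ if and only if one of the following conditions holds: (i) $M=\emptyset$; (ii) $d_G(x,u)=d_G(x,v)$ for any $x\in M$; (iii) for any $x\in M$ with $d_G(x,u)=d_G(x,v)+1$, we have $d_{G-uv}(x,u)=d_G(x,u)$.
   Context: Graphs are finite, undirected and simple. The symbol $\subset$ denotes (not necessarily strict) inclusion. $d_G(x,y)$ is the distance between $x$ and $y$ in $G$ ($\infty$ if there is no path), and $G-e$ is the graph obtained from $G$ by deleting the edge $e$. For $M\subseteq V(G)$ and an edge $e$ of $G$, $P(M,e)$ is the set of ordered pairs $(x,y)$ with $x\in M$, $y\in V(G)$ and $d_G(x,y)\neq d_{G-e}(x,y)$.
   Formalization: Condition (iii) is required for both ends of the edge (also with u and v exchanged); as printed it is false, e.g. for G = K_2 with edge uv and M = {u}, where (iii) holds vacuously but (u,v) lies in P(M,uv). *)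

(* Defs.v *)
From mathcomp Require Import all_boot.

Set Implicit Arguments.
Unset Strict Implicit.
Unset Printing Implicit Defensive.

(* A finite simple graph is a symmetric irreflexive relation [g : rel V] on a
   finite type; its edges are the sets [[set x; y]] with [g x y]. *)
Section Graph.
Variables (V : finType) (g : rel V).

(* There is a (non self-intersecting) path with k edges from x to y. *)
Definition has_path (x y : V) (k : nat) : bool :=
  [exists p : k.-tuple V, [&& path g x p, uniq (x :: p) & last x p == y]].

Lemma connect_has_path x y : connect g x y -> exists k, has_path x y k.
Proof.
case/connectP=> p gp ->; case/shortenP: gp => q gq uq _.
by exists (size q); apply/existsP; exists (in_tuple q); rewrite /= gq eqxx andbT.
Qed.

(* [None] stands for the infinite distance. *)
Definition dist (x y : V) : option nat :=
  if @idP (connect g x y) is ReflectT xy then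
    Some (ex_minn (connect_has_path xy))
  else None.

Definition del_edge (e : {set V}) : rel V :=
  [rel x y | g x y && ([set x; y] != e)].

End Graph.

(* Successor on extended naturals; infinity + 1 = infinity. *)
Definition succ_dist (d : option nat) : option nat := omap succn d.

Definition P (V : finType) (g : rel V) (M : {set V}) (e : {set V}) :
    {set V * V} :=
  [set xy | (xy.1 \in M) &&
            (dist g xy.1 xy.2 != dist (del_edge g e) xy.1 xy.2)].

(* Main.v *)
Require Import Defs.
From mathcomp Require Import all_boot.

(* Follow a shortest path from x and replace it, vertex by vertex, by one of the
   same length avoiding uv: the only problematic step is crossing the edge uv,
   which forces d(x,u) and d(x,v) to differ by one, and then the hypothesis of
   (iii) provides a path avoiding uv.  So (iii) implies that no distance from M
   changes.  Condition (ii) implies (iii), since d = d + 1 only for d infinite,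
   and then the distance in G - uv is infinite as well. *)

Section Distance.
Set Implicit Arguments.
Unset Strict Implicit.
Variables (V : finType) (g : rel V).

Lemma dist_path (x y : V) (k : nat) :
  dist g x y = Some k -> exists2 p, path g x p & last x p = y /\ size p = k.
Proof.
rewrite /dist; case: {-}_ / idP => // xy [<-]; case: ex_minnP => m.
case/existsP=> p /and3P[gp _ /eqP lp] _.
by exists p => //; rewrite size_tuple.
Qed.

Lemma dist_le_size (x : V) (p : seq V) :
  path g x p -> exists2 k, dist g x (last x p) = Some k & k <= size p.
Proof.
move=> gp; have xy : connect g x (last x p) by apply/connectP; exists p.
rewrite /dist; case: {-}_ / idP => // {}xy.
eexists; first by [].
(* [dist] counts only paths without repeated vertices, so [p] is shortened to such a [q], whose
   vertices are among those of [p]. *)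
case: ex_minnP => m _; case/shortenP: gp xy => q gq uq sub xy mmin.
apply: leq_trans (uniq_leq_size (proj2 (andP uq)) sub).
by apply: mmin; apply/existsP; exists (in_tuple q); rewrite gq uq /=.
Qed.

(** A shorter path to the last vertex of [p], extended by [y], would beat the distance to [y]. *)
Lemma dist_rcons (x y : V) (p : seq V) :
  path g x (rcons p y) -> dist g x y = Some (size p).+1 ->
  dist g x (last x p) = Some (size p).
Proof.
rewrite rcons_path => /andP[gp gy] dy.
have [k dk lek] := dist_le_size gp.
have [q gq [lq sq]] := dist_path dk.
have gqy : path g x (rcons q y) by rewrite rcons_path gq lq.
have [m] := dist_le_size gqy.
rewrite last_rcons dy size_rcons sq => -[<-]; rewrite ltnS => gek.
by rewrite dk; congr Some; apply/eqP; rewrite eqn_leq lek.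
Qed.

End Distance.

Section DeleteEdge.
Set Implicit Arguments.
Unset Strict Implicit.
Variables (V : finType) (g : rel V).

Lemma dist_subrel (h : rel V) (x y : V) (k : nat) :
  subrel h g -> dist h x y = Some k -> exists2 m, dist g x y = Some m & m <= k.
Proof.
move=> hg /dist_path[p hp [<- <-]].
exact: (dist_le_size (sub_path hg hp)).
Qed.

Lemma del_edge_subrel (e : {set V}) : subrel (del_edge g e) g.
Proof. by move=> x y /andP[]. Qed.

Lemma dist_del_edge_None (e : {set V}) (x y : V) :
  dist g x y = None -> dist (del_edge g e) x y = None.
Proof.
case dk : (dist (del_edge g e) x y) => [k|//] dg.
by have [m] := dist_subrel (@del_edge_subrel e) dk; rewrite dg.
Qed.

Lemma eq_set2 (x y u v : V) :
  [set x; y] = [set u; v] -> (x = u /\ y = v) \/ (x = v /\ y = u).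
Proof.
move/setP=> E; move: (E x) (E y) (E u) (E v); rewrite !inE !eqxx /= ?orbT.
move=> /esym/orP[]/eqP-> /esym/orP[]/eqP-> //; rewrite ?eqxx ?orbb; auto.
(* The two cases left have [x = y]; then [[set u; v]] is a singleton and [u = v]. *)
- by move=> _ /eqP->; auto.
- by move=> /eqP-> _; auto.
Qed.

(** A shortest path from [x] may cross the edge in either direction, hence one hypothesis for
    each. *)
Lemma dist_del_edge_eq (u v x : V) :
  (dist g x u = succ_dist (dist g x v) ->
   dist (del_edge g [set u; v]) x u = dist g x u) ->
  (dist g x v = succ_dist (dist g x u) ->
   dist (del_edge g [set u; v]) x v = dist g x v) ->
  forall y, dist (del_edge g [set u; v]) x y = dist g x y.
Proof.
set h := del_edge g _ => Hu Hv y.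
case dg : (dist g x y) => [k|]; last exact: dist_del_edge_None.
(* Deleting an edge never shortens a distance, so the upper bound is enough. *)
suff: exists2 m, dist h x y = Some m & m <= k.
  case=> m dh lemk; rewrite dh; congr Some; apply/eqP; rewrite eqn_leq lemk.
  have [n] := dist_subrel (@del_edge_subrel [set u; v]) dh.
  by rewrite dg => -[<-].
have [p gp [lp sp]] := dist_path dg.
(* Prefixes of a shortest path are shortest paths to other vertices, so [y] and [k] vary in the
   induction. *)
elim/last_ind: p y k gp lp sp dg => [|p z IH] y k gp.
  by move=> /= <- <- _; apply: (@dist_le_size _ h x [::]).
rewrite last_rcons size_rcons => <- <- dz.
have dp := dist_rcons gp dz.
move: gp; rewrite rcons_path => /andP[gp gz].
have [/eq_set2 E | ne] := eqVneq [set last x p; z] [set u; v].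
  (* The last step is the deleted edge: [dz] and [dp] give the premise of [Hv] or [Hu], according to
     the direction of crossing. *)
  exists (size p).+1 => //; rewrite -dz.
  case: E => -[E1 E2]; rewrite E1 in dp; subst z.
    by apply: Hv; rewrite dz dp.
  by apply: Hu; rewrite dz dp.
have [m dm lem] := IH _ _ gp erefl erefl dp.
have [q hq [lq sq]] := dist_path dm.
have hqz : path h x (rcons q z) by rewrite rcons_path hq lq /h /del_edge /= gz.
have [n] := dist_le_size hqz; rewrite last_rcons size_rcons sq => dn len.
by exists n => //; apply: leq_trans len _.
Qed.

End DeleteEdge.

Theorem proposition3p5 (V : finType) (g : rel V)
    (g_sym : symmetric g) (g_irr : irreflexive g)
    (u v : V) (uv_edge : g u v) (M : {set V}) :
  #|P g M [set u; v]| = 0 <->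
  [\/ M = set0,
      forall x : V, x \in M -> dist g x u = dist g x v
    | forall x : V, x \in M ->
        (dist g x u = succ_dist (dist g x v) ->
         dist (del_edge g [set u; v]) x u = dist g x u) /\
        (dist g x v = succ_dist (dist g x u) ->
         dist (del_edge g [set u; v]) x v = dist g x v)].
Proof.
split=> [/eqP|H].
  (* The third condition is the weakest of the three, so it is the one to derive. *)
  rewrite cards_eq0 => /eqP P0; apply: Or33 => x xM.
  have eqd y : dist (del_edge g [set u; v]) x y = dist g x y.
    by have /setP/(_ (x, y)) := P0; rewrite !inE xM => /negbFE/eqP.
  by split=> _; apply: eqd.
apply/eqP; rewrite cards_eq0; apply/eqP/setP=> -[x y]; rewrite !inE /=.
apply/negbTE; rewrite negb_and negbK -implybE; apply/implyP=> xM.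
rewrite eq_sym; apply/eqP.
case: H => [M0 | H | /(_ x xM)[Hu Hv]]; last exact: (dist_del_edge_eq Hu Hv).
  by rewrite M0 inE in xM.
move: (H x xM) => E.
have inf d : d = succ_dist d -> d = None.
  by case: d => // k [] /eqP; rewrite -[k == _]/(k == k.+1) ltn_eqF.
by apply: dist_del_edge_eq; rewrite E => /inf d;
  rewrite d; apply: dist_del_edge_None; rewrite ?E.
Qed.
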